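(* Any non-trivial 2-dimensional real algebra is isomorphic to one and only one of the following algebras, listed by their matrices of structure constants (different parameter values count as different members of the list): \[A_{1,r}(\alpha_1,\alpha_2,\alpha_4,\beta_1)=\begin{pmatrix}\alpha_1&\alpha_2&\alpha_2+1&\alpha_4\\ \beta_1&-\alpha_1&-\alpha_1+1&-\alpha_2\end{pmatrix},\quad (\alpha_1,\alpha_2,\alpha_4,\beta_1)\in\mathbb{R}^4,\] \[A_{2,r}(\alpha_1,\beta_1,\beta_2)=\begin{pmatrix}\alpha_1&0&0&1\\ \beta_1&\beta_2&1-\alpha_1&0\end{pmatrix},\quad (\alpha_1,\beta_1,\beta_2)\in\mathbb{R}^3,\ \beta_1\ge 0,\] \[A_{3,r}(\alpha_1,\beta_1,\beta_2)=\begin{pmatrix}\alpha_1&0&0&-1\\ \beta_1&\beta_2&1-\alpha_1&0\end{pmatrix},\quad (\alpha_1,\beta_1,\beta_2)\in\mathbb{R}^3,\ \beta_1\ge 0,\] \[A_{4,r}(\beta_1,\beta_2)=\begin{pmatrix}0&1&1&0\\ \beta_1&\beta_2&1&-1\end{pmatrix},\quad (\beta_1,\beta_2)\in\mathbb{R}^2,\] \[A_{5,r}(\alpha_1,\beta_2)=\begin{pmatrix}\alpha_1&0&0&0\\ 0&\beta_2&1-\alpha_1&0\end{pmatrix},\quad (\alpha_1,\beta_2)\in\mathbb{R}^2,\] \[A_{6,r}(\alpha_1)=\begin{pmatrix}\alpha_1&0&0&0\\ 1&2\alpha_1-1&1-\alpha_1&0\end{pmatrix},\quad \alpha_1\in\mathbb{R},\]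 \[A_{7,r}(\alpha_1,\beta_1)=\begin{pmatrix}\alpha_1&0&0&1\\ \beta_1&1-\alpha_1&-\alpha_1&0\end{pmatrix},\quad (\alpha_1,\beta_1)\in\mathbb{R}^2,\ \beta_1\ge 0,\] \[A_{8,r}(\alpha_1,\beta_1)=\begin{pmatrix}\alpha_1&0&0&-1\\ \beta_1&1-\alpha_1&-\alpha_1&0\end{pmatrix},\quad (\alpha_1,\beta_1)\in\mathbb{R}^2,\ \beta_1\ge 0,\] \[A_{9,r}(\beta_1)=\begin{pmatrix}0&1&1&0\\ \beta_1&1&0&-1\end{pmatrix},\quad \beta_1\in\mathbb{R},\] \[A_{10,r}(\alpha_1)=\begin{pmatrix}\alpha_1&0&0&0\\ 0&1-\alpha_1&-\alpha_1&0\end{pmatrix},\quad \alpha_1\in\mathbb{R},\] \[A_{11,r}=\begin{pmatrix}\frac13&0&0&0\\ 1&\frac23&-\frac13&0\end{pmatrix},\quad A_{12,r}=\begin{pmatrix}0&1&1&0\\ 1&0&0&-1\end{pmatrix},\quad A_{13,r}=\begin{pmatrix}0&1&1&0\\ -1&0&0&-1\end{pmatrix},\] \[A_{14,r}=\begin{pmatrix}0&1&1&0\\ 0&0&0&-1\end{pmatrix},\quad A_{15,r}=\begin{pmatrix}0&0&0&0\\ 1&0&0&0\end{pmatrix}.\]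
   Context: A 2-dimensional real algebra is a 2-dimensional real vector space $\mathbb{A}$ with a bilinear multiplication $\cdot$ (not necessarily associative, commutative or unital); it is non-trivial if the multiplication is not identically zero. Given a basis $(e_1,e_2)$, its matrix of structure constants (MSC) is \[A=\begin{pmatrix}A^1_{1,1}&A^1_{1,2}&A^1_{2,1}&A^1_{2,2}\\ A^2_{1,1}&A^2_{1,2}&A^2_{2,1}&A^2_{2,2}\end{pmatrix},\qquad e_i\cdot e_j=A^1_{i,j}e_1+A^2_{i,j}e_2.\] Equivalently, in coordinates $\mathbf{u}\cdot\mathbf{v}$ has coordinate column $A(u\otimes v)$, where $u\otimes v=(u_1v_1,u_1v_2,u_2v_1,u_2v_2)^T$. Two algebras with MSCs $A$ and $B$ are isomorphic if and only if $B=gA(g^{-1}\otimes g^{-1})$ for some $g\in GL(2,\mathbb{R})$, where $\otimes$ is the Kronecker product. An algebra is identified with its MSC. *)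

(* Defs.v *)
From HB Require Import structures.
From mathcomp Require Import all_boot all_order all_algebra.
From mathcomp Require Import sesquilinear.
From mathcomp Require Import mxtens.
From mathcomp Require Import reals.

Set Implicit Arguments.
Unset Strict Implicit.
Unset Printing Implicit Defensive.

Import Order.TTheory GRing.Theory Num.Theory.
Local Open Scope ring_scope.

Definition alg_isomorphic (R : realType) (V W : lmodType R)
    (mulV : {bilinear V -> V -> V}) (mulW : {bilinear W -> W -> W}) : Prop :=
  exists f : {linear V -> W},
    bijective f /\ forall x y : V, f (mulV x y) = mulW (f x) (f y).

(* The product on R^2 with matrix of structure constants A; the columns of A
   are indexed by (1,1), (1,2), (2,1), (2,2), the order used by tensmx. *)
Definition msc_mul (R : realType) (A : 'M[R]_(2, 4)) (u v : 'cV[R]_2) :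
  'cV[R]_2 := A *m (tensmx u v).

Lemma msc_mulE (R : realType) (A : 'M[R]_(2, 4)) (u v : 'cV[R]_2) (k : 'I_2) :
  msc_mul A u v k 0 =
    A k (inord 0) * (u (inord 0) 0 * v (inord 0) 0)
  + A k (inord 1) * (u (inord 0) 0 * v (inord 1) 0)
  + A k (inord 2) * (u (inord 1) 0 * v (inord 0) 0)
  + A k (inord 3) * (u (inord 1) 0 * v (inord 1) 0).
Proof.
rewrite mxE !big_ord_recr big_ord0 /= add0r !mxE.
by congr (_ + _ + _ + _); (congr (_ * (_ * _));
  [congr (A _ _)|congr (u _ _)|congr (v _ _)]);
  apply: val_inj; rewrite /= ?inordK.
Qed.

Lemma msc_mul_bilinear (R : realType) (A : 'M[R]_(2, 4)) :
  bilinear_for (GRing.Scale.Law.clone _ _ *:%R _)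
               (GRing.Scale.Law.clone _ _ *:%R _) (msc_mul A).
Proof.
split=> w a u v; rewrite /= /msc_mul scalemxAr -mulmxDr; congr (_ *m _);
  apply/matrixP=> i j; rewrite !mxE.
  by rewrite mulrDl mulrA.
by rewrite mulrDr mulrCA.
Qed.

HB.instance Definition _ (R : realType) (A : 'M[R]_(2, 4)) :=
  bilinear_isBilinear.Build R 'cV[R]_2 'cV[R]_2 'cV[R]_2 _ _ (msc_mul A)
    (msc_mul_bilinear A).

Definition mx2x4 (R : realType) (a1 a2 a3 a4 b1 b2 b3 b4 : R) : 'M[R]_(2, 4) :=
  \matrix_(i < 2, j < 4)
    nth 0 (nth [::] [:: [:: a1; a2; a3; a4];
                        [:: b1; b2; b3; b4]] i) j.

Inductive canonical_alg (R : realType) : Type :=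
| A1 (a1 a2 a4 b1 : R)
| A2 (a1 b1 b2 : R)
| A3 (a1 b1 b2 : R)
| A4 (b1 b2 : R)
| A5 (a1 b2 : R)
| A6 (a1 : R)
| A7 (a1 b1 : R)
| A8 (a1 b1 : R)
| A9 (b1 : R)
| A10 (a1 : R)
| A11
| A12
| A13
| A14
| A15.

Definition admissible (R : realType) (c : canonical_alg R) : bool :=
  match c with
  | A2 _ b1 _ | A3 _ b1 _ | A7 _ b1 | A8 _ b1 => 0 <= b1
  | _ => true
  end.

Definition msc (R : realType) (c : canonical_alg R) : 'M[R]_(2, 4) :=
  match c with
  | A1 a1 a2 a4 b1 => mx2x4 a1 a2 (a2 + 1) a4
                            b1 (- a1) (- a1 + 1) (- a2)
  | A2 a1 b1 b2 => mx2x4 a1 0 0 1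
                         b1 b2 (1 - a1) 0
  | A3 a1 b1 b2 => mx2x4 a1 0 0 (-1)
                         b1 b2 (1 - a1) 0
  | A4 b1 b2 => mx2x4 0 1 1 0
                      b1 b2 1 (-1)
  | A5 a1 b2 => mx2x4 a1 0 0 0
                      0 b2 (1 - a1) 0
  | A6 a1 => mx2x4 a1 0 0 0
                   1 (2 * a1 - 1) (1 - a1) 0
  | A7 a1 b1 => mx2x4 a1 0 0 1
                      b1 (1 - a1) (- a1) 0
  | A8 a1 b1 => mx2x4 a1 0 0 (-1)
                      b1 (1 - a1) (- a1) 0
  | A9 b1 => mx2x4 0 1 1 0
                   b1 1 0 (-1)
  | A10 a1 => mx2x4 a1 0 0 0
                    0 (1 - a1) (- a1) 0
  | A11 => mx2x4 (1 / 3) 0 0 0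
                 1 (2 / 3) (- (1 / 3)) 0
  | A12 => mx2x4 0 1 1 0
                 1 0 0 (-1)
  | A13 => mx2x4 0 1 1 0
                 (-1) 0 0 (-1)
  | A14 => mx2x4 0 1 1 0
                 0 0 0 (-1)
  | A15 => mx2x4 0 0 0 0
                 1 0 0 0
  end.

(* Main.v *)
Require Import Defs.
From HB Require Import structures.
From mathcomp Require Import all_boot all_order all_algebra.
From mathcomp Require Import sesquilinear.
From mathcomp Require Import reals.
From mathcomp Require Import polyrcf ring lra.

Set Implicit Arguments.
Unset Strict Implicit.
Unset Printing Implicit Defensive.

Import Order.TTheory GRing.Theory Num.Theory.
Local Open Scope ring_scope.

(* The traces of the left and of the right multiplications are two linear forms
   on the algebra, natural under isomorphism.  If they are independent, their
   dual basis is canonical and gives A1.  If they span a line, choose e1, e2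
   with the values 1, 0 under a nonzero one of them; only the changes
   (e1 + c e2, d e2) remain, and c, d can be used to reach A2, ..., A11.  If
   both vanish, the algebra is encoded by the binary cubic x |-> det (x, x * x);
   a real root of it reduces the constants to A12, ..., A15. *)

(** * Isomorphism of algebras, abstractly and in coordinates *)

Section Isomorphism.
Variable R : realType.

Lemma alg_isomorphic_sym (V W : lmodType R) (mulV : {bilinear V -> V -> V})
    (mulW : {bilinear W -> W -> W}) :
  alg_isomorphic mulV mulW -> alg_isomorphic mulW mulV.
Proof.
move=> [f [[g fK gK] fM]].
pose gL : {linear W -> V} :=
  HB.pack g (GRing.isLinear.Build _ _ _ _ g (GRing.can2_linear fK gK)).
exists gL; split=> [|x y]; first by exists f.
by apply: (can_inj fK); rewrite fM /= !gK.
Qed.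

Lemma alg_isomorphic_trans (U V W : lmodType R)
    (mulU : {bilinear U -> U -> U}) (mulV : {bilinear V -> V -> V})
    (mulW : {bilinear W -> W -> W}) :
  alg_isomorphic mulU mulV -> alg_isomorphic mulV mulW ->
  alg_isomorphic mulU mulW.
Proof.
move=> [f [bf fM]] [g [bg gM]].
exists (g \o f); split=> [|x y] /=; first exact: bij_comp.
by rewrite fM gM.
Qed.

Definition vec2 (x y : R) : 'cV[R]_2 := \col_i (if i == 0 then x else y).

Lemma vec2E (x y : R) : (vec2 x y 0 0 = x) * (vec2 x y 1 0 = y).
Proof. by rewrite !mxE. Qed.

Lemma vec2_inj (x y x' y' : R) : vec2 x y = vec2 x' y' -> x = x' /\ y = y'.
Proof.
by move=> E; rewrite -(vec2E x y) -(vec2E x' y').1 E -(vec2E x y).2 E !vec2E.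
Qed.

Lemma vec2_eta (u : 'cV[R]_2) : u = vec2 (u 0 0) (u 1 0).
Proof.
apply/matrixP=> i j; rewrite ord1 mxE.
by case: i => [[|[|i]] // Hi]; congr (u _ _); apply: val_inj.
Qed.

Lemma vec2D (x y x' y' k : R) :
  k *: vec2 x y + vec2 x' y' = vec2 (k * x + x') (k * y + y').
Proof. by apply/matrixP=> i j; rewrite !mxE; case: ifP. Qed.

Definition bil2 (a b c d x y x' y' : R) : R :=
  a * (x * x') + b * (x * y') + c * (y * x') + d * (y * y').

Lemma msc_mul_vec2 (a1 a2 a3 a4 b1 b2 b3 b4 x y x' y' : R) :
  msc_mul (mx2x4 a1 a2 a3 a4 b1 b2 b3 b4) (vec2 x y) (vec2 x' y') =
  vec2 (bil2 a1 a2 a3 a4 x y x' y') (bil2 b1 b2 b3 b4 x y x' y').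
Proof.
have i0 : inord 0 = 0 :> 'I_2 by apply: val_inj; rewrite /= inordK.
have i1 : inord 1 = 1 :> 'I_2 by apply: val_inj; rewrite /= inordK.
by rewrite [LHS]vec2_eta !msc_mulE !i0 !i1 !vec2E !mxE /= !inordK.
Qed.

Lemma mx2x4_eta (A : 'M[R]_(2, 4)) :
  exists a1 a2 a3 a4 b1 b2 b3 b4 : R, A = mx2x4 a1 a2 a3 a4 b1 b2 b3 b4.
Proof.
pose a i j := A (inord i) (inord j).
exists (a 0 0)%N, (a 0 1)%N, (a 0 2)%N, (a 0 3)%N.
exists (a 1 0)%N, (a 1 1)%N, (a 1 2)%N, (a 1 3)%N.
apply/matrixP=> i j; rewrite mxE /a.
by case: i => [[|[|i]] // Hi]; case: j => [[|[|[|[|j]]]] // Hj] /=;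
  congr (A _ _); apply: val_inj; rewrite /= inordK.
Qed.

Lemma mx2x4_inj (a1 a2 a3 a4 b1 b2 b3 b4 a1' a2' a3' a4' b1' b2' b3' b4' : R) :
  mx2x4 a1 a2 a3 a4 b1 b2 b3 b4 = mx2x4 a1' a2' a3' a4' b1' b2' b3' b4' ->
  [/\ a1 = a1', a2 = a2', a3 = a3' & a4 = a4'] /\
  [/\ b1 = b1', b2 = b2', b3 = b3' & b4 = b4'].
Proof.
move=> E; have H i j := congr1 (fun A : 'M_(2, 4) => A (inord i) (inord j)) E.
have := (H 0%N 0%N, H 0%N 1%N, H 0%N 2%N, H 0%N 3%N,
         (H 1%N 0%N, H 1%N 1%N, H 1%N 2%N, H 1%N 3%N)).
by rewrite !mxE !inordK //= => -[[[[-> ->] ->] ->] [[[-> ->] ->] ->]].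
Qed.

(* (p, q) and (r, s) are the coordinates of the images of e1 and e2. *)
Lemma alg_isomorphic_mx2x4P
    (a1 a2 a3 a4 b1 b2 b3 b4 a1' a2' a3' a4' b1' b2' b3' b4' : R) :
  alg_isomorphic (msc_mul (mx2x4 a1 a2 a3 a4 b1 b2 b3 b4))
    (msc_mul (mx2x4 a1' a2' a3' a4' b1' b2' b3' b4')) <->
  exists p q r s : R, let A := bil2 a1' a2' a3' a4' in
    let B := bil2 b1' b2' b3' b4' in
    [/\ p * s - q * r != 0,
     [/\ a1 * p + b1 * r = A p q p q, a2 * p + b2 * r = A p q r s,
         a3 * p + b3 * r = A r s p q & a4 * p + b4 * r = A r s r s]
   & [/\ a1 * q + b1 * s = B p q p q, a2 * q + b2 * s = B p q r s,
         a3 * q + b3 * s = B r s p q & a4 * q + b4 * s = B r s r s]].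
Proof.
split=> [[f [bf fM]] | [p [q [r [s [dN0 [E1 E2 E3 E4] [F1 F2 F3 F4]]]]]]].
  pose e1 := vec2 1 0; pose e2 := vec2 0 1.
  pose p := f e1 0 0; pose q := f e1 1 0; pose r := f e2 0 0; pose s := f e2 1 0.
  have fE x y : f (vec2 x y) = vec2 (x * p + y * r) (x * q + y * s).
    have -> : vec2 x y = x *: e1 + y *: e2.
      by apply/matrixP=> i j; rewrite !mxE; case: ifP => _; ring.
    rewrite linearD !linearZ [f e1]vec2_eta [f e2]vec2_eta.
    by apply/matrixP=> i j; rewrite !mxE; case: ifP.
  exists p, q, r, s => A B.
  have H (x y x' y' : R) : f (msc_mul (mx2x4 a1 a2 a3 a4 b1 b2 b3 b4)
      (vec2 x y) (vec2 x' y')) = msc_mul (mx2x4 a1' a2' a3' a4' b1' b2' b3' b4')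
      (f (vec2 x y)) (f (vec2 x' y')) := fM _ _.
  have := (H 1 0 1 0, H 1 0 0 1, (H 0 1 1 0, H 0 1 0 1)).
  rewrite !fE !msc_mul_vec2 !fE /bil2 !mul1r !mul0r !addr0 !add0r.
  rewrite !(mul0r, mulr0, mul1r, mulr1, addr0, add0r).
  move=> [[/vec2_inj[-> ->] /vec2_inj[-> ->]] [/vec2_inj[-> ->] /vec2_inj[-> ->]]].
  split=> //; apply/negP=> /eqP d0.
  (* If the determinant vanishes, [f] kills (s, -q) and (r, -p); by injectivity all four entries are
     0, so [f] is zero. *)
  have k1 : vec2 s (- q) = vec2 0 0.
    by apply: (bij_inj bf); rewrite !fE; congr vec2; [rewrite !mul0r addr0 -d0|]; ring.
  have k2 : vec2 r (- p) = vec2 0 0.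
    apply: (bij_inj bf); rewrite !fE; congr vec2; first by ring.
    by apply: oppr_inj; rewrite !mul0r addr0 oppr0 -d0; ring.
  have [s0 /eqP] := vec2_inj k1; have [r0 /eqP] := vec2_inj k2.
  rewrite !oppr_eq0 => /eqP p0 /eqP q0.
  have /(bij_inj bf)/vec2_inj[/eqP] : f (vec2 1 0) = f (vec2 0 0).
    by rewrite !fE p0 q0 r0 s0; congr vec2; ring.
  by rewrite oner_eq0.
pose d := p * s - q * r; rewrite -/d in dN0.
pose f (u : 'cV[R]_2) := vec2 (u 0 0 * p + u 1 0 * r) (u 0 0 * q + u 1 0 * s).
pose h (u : 'cV[R]_2) :=
  vec2 ((u 0 0 * s - u 1 0 * r) / d) ((u 1 0 * p - u 0 0 * q) / d).
have flin : linear f.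
  move=> k u v; rewrite /f vec2D; congr vec2; rewrite !mxE; ring.
pose fL : {linear 'cV[R]_2 -> 'cV[R]_2} :=
  HB.pack f (GRing.isLinear.Build _ _ _ _ f flin).
exists fL; split.
  exists h => u; rewrite [RHS]vec2_eta /fL /= /h /f !vec2E; congr vec2;
  by rewrite /d in dN0 *; field.
move=> u v; rewrite (vec2_eta u) (vec2_eta v); move: (u 0 0) (u 1 0) (v 0 0) (v 1 0).
move=> x y x' y'; rewrite /fL /= /f !vec2E !msc_mul_vec2 !vec2E.
move: E1 E2 E3 E4 F1 F2 F3 F4; rewrite /bil2 => E1 E2 E3 E4 F1 F2 F3 F4.
congr vec2.
  transitivity ((a1 * p + b1 * r) * (x * x') + (a2 * p + b2 * r) * (x * y')
     + (a3 * p + b3 * r) * (y * x') + (a4 * p + b4 * r) * (y * y')).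
    by ring.
  by rewrite E1 E2 E3 E4; ring.
transitivity ((a1 * q + b1 * s) * (x * x') + (a2 * q + b2 * s) * (x * y')
   + (a3 * q + b3 * s) * (y * x') + (a4 * q + b4 * s) * (y * y')).
  by ring.
by rewrite F1 F2 F3 F4; ring.
Qed.

Lemma exists_msc (V : vectType R) (mul : {bilinear V -> V -> V}) :
  \dim {:V} = 2%N -> exists A, alg_isomorphic mul (msc_mul A).
Proof.
move=> dimV; have := vbasisP {:V}; move: (vbasis _); rewrite dimV => X bX.
have /andP[/eqP spX frX] := bX.
pose f v := vec2 (coord X 0 v) (coord X 1 v).
pose h (u : 'cV[R]_2) := u 0 0 *: X`_0 + u 1 0 *: X`_1.
have flin : linear f by move=> k u v; rewrite /f vec2D !linearP.
pose fL : {linear V -> 'cV[R]_2} :=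
  HB.pack f (GRing.isLinear.Build _ _ _ _ f flin).
have fK : cancel f h.
  move=> v; rewrite /h /f !vec2E.
  have vX : v \in <<X>>%VS by rewrite spX memvf.
  have -> : 1 = lift ord0 ord0 :> 'I_2 by apply: val_inj.
  by rewrite [RHS](coord_span vX) big_ord_recl big_ord1.
have hK : cancel h f.
  move=> u; rewrite [RHS]vec2_eta /f /h !linearD !linearZ /=.
  have c0 j : coord X j X`_0 = (0 == j)%:R by exact: (coord_free 0).
  have c1 j : coord X j X`_1 = (1 == j)%:R by exact: (coord_free 1).
  rewrite !c0 !c1.
  by congr vec2; rewrite /= !(mulr0, mulr1, addr0, add0r).
have hE x y : h (vec2 x y) = x *: X`_0 + y *: X`_1 by rewrite /h !vec2E.
pose a (k i j : 'I_2) := f (mul X`_i X`_j) k 0.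
exists (mx2x4 (a 0 0 0) (a 0 0 1) (a 0 1 0) (a 0 1 1)
         (a 1 0 0) (a 1 0 1) (a 1 1 0) (a 1 1 1)).
exists fL; split; first by exists h.
(* Every vector is [h] of its coordinates, so products need only be compared on combinations of the
   basis. *)
move=> u v; rewrite -(fK u) -(fK v).
move: (f u) (f v) => {}u {}v; rewrite /fL /= !hK.
rewrite [u]vec2_eta [v]vec2_eta !hE msc_mul_vec2.
move: (u 0 0) (u 1 0) (v 0 0) (v 1 0) => x y x' y'.
rewrite linearDl /= !linearDr /= !linearZl /= !linearZr /= -/fL.
rewrite -[f]/(fL : _ -> _) !linearD !linearZ /=.
rewrite [LHS]vec2_eta; congr vec2; rewrite /bil2 /a /f !mxE /=; ring.
Qed.

End Isomorphism.

(** * Trace forms, and normal forms when they span a line *)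

Section Invariants.
Variable R : realType.

(** On (e1, e2) the left trace form has the values (a1 + b2, a3 + b4) and the right one (a1 + b3, a2
    + b4). An isomorphism conjugates the multiplication operators, so the forms of the source are
    the pullbacks of those of the target. *)
Lemma trace_forms (a1 a2 a3 a4 b1 b2 b3 b4 a1' a2' a3' a4' b1' b2' b3' b4'
    p q r s : R) (A := bil2 a1' a2' a3' a4') (B := bil2 b1' b2' b3' b4') :
  p * s - q * r != 0 ->
  [/\ a1 * p + b1 * r = A p q p q, a2 * p + b2 * r = A p q r s,
      a3 * p + b3 * r = A r s p q & a4 * p + b4 * r = A r s r s] ->
  [/\ a1 * q + b1 * s = B p q p q, a2 * q + b2 * s = B p q r s,
      a3 * q + b3 * s = B r s p q & a4 * q + b4 * s = B r s r s] ->
  [/\ a1 + b2 = (a1' + b2') * p + (a3' + b4') * q,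
      a3 + b4 = (a1' + b2') * r + (a3' + b4') * s,
      a1 + b3 = (a1' + b3') * p + (a2' + b4') * q
    & a2 + b4 = (a1' + b3') * r + (a2' + b4') * s].
Proof.
rewrite /A /B /bil2 => dN0 [E1 E2 E3 E4] [F1 F2 F3 F4].
split; apply: (mulfI dN0).
(* By Cramer's rule this combination is the determinant times [a1 + b2]; the other three equations
   are obtained alike. *)
- transitivity (s * (a1 * p + b1 * r) - r * (a1 * q + b1 * s)
    - q * (a2 * p + b2 * r) + p * (a2 * q + b2 * s)); first by ring.
  by rewrite E1 F1 E2 F2; ring.
- transitivity (s * (a3 * p + b3 * r) - r * (a3 * q + b3 * s)
    - q * (a4 * p + b4 * r) + p * (a4 * q + b4 * s)); first by ring.
  by rewrite E3 F3 E4 F4; ring.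
- transitivity (s * (a1 * p + b1 * r) - r * (a1 * q + b1 * s)
    - q * (a3 * p + b3 * r) + p * (a3 * q + b3 * s)); first by ring.
  by rewrite E1 F1 E3 F3; ring.
- transitivity (s * (a2 * p + b2 * r) - r * (a2 * q + b2 * s)
    - q * (a4 * p + b4 * r) + p * (a4 * q + b4 * s)); first by ring.
  by rewrite E2 F2 E4 F4; ring.
Qed.

(** Passage to the basis of the vectors (p, q) and (r, s). Only the traces of the new constants are
    recorded, since bases will be chosen to prescribe them. *)
Lemma change_of_basis (a1 a2 a3 a4 b1 b2 b3 b4 p q r s : R) :
  p * s - q * r != 0 ->
  exists a1' a2' a3' a4' b1' b2' b3' b4' : R,
    alg_isomorphic (msc_mul (mx2x4 a1 a2 a3 a4 b1 b2 b3 b4))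
      (msc_mul (mx2x4 a1' a2' a3' a4' b1' b2' b3' b4')) /\
    [/\ a1' + b2' = (a1 + b2) * p + (a3 + b4) * q,
        a3' + b4' = (a1 + b2) * r + (a3 + b4) * s,
        a1' + b3' = (a1 + b3) * p + (a2 + b4) * q
      & a2' + b4' = (a1 + b3) * r + (a2 + b4) * s].
Proof.
move=> dN0; pose A := bil2 a1 a2 a3 a4; pose B := bil2 b1 b2 b3 b4.
pose X x y := (s * x - r * y) / (p * s - q * r).
pose Y x y := (p * y - q * x) / (p * s - q * r).
have XE x y : X x y * p + Y x y * r = x by rewrite /X /Y; field.
have YE x y : X x y * q + Y x y * s = y by rewrite /X /Y; field.
have E : [/\ X (A p q p q) (B p q p q) * p + Y (A p q p q) (B p q p q) * r = A p q p q,
    X (A p q r s) (B p q r s) * p + Y (A p q r s) (B p q r s) * r = A p q r s,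
    X (A r s p q) (B r s p q) * p + Y (A r s p q) (B r s p q) * r = A r s p q
    & X (A r s r s) (B r s r s) * p + Y (A r s r s) (B r s r s) * r = A r s r s].
  by rewrite !XE.
have F : [/\ X (A p q p q) (B p q p q) * q + Y (A p q p q) (B p q p q) * s = B p q p q,
    X (A p q r s) (B p q r s) * q + Y (A p q r s) (B p q r s) * s = B p q r s,
    X (A r s p q) (B r s p q) * q + Y (A r s p q) (B r s p q) * s = B r s p q
    & X (A r s r s) (B r s r s) * q + Y (A r s r s) (B r s r s) * s = B r s r s].
  by rewrite !YE.
do 8 eexists; split; last exact: trace_forms dN0 E F.
by apply/alg_isomorphic_sym/alg_isomorphic_mx2x4P; exists p, q, r, s.
Qed.

(* The new basis is (e1 + c e2, d e2). *)
Lemma triangular_change (a1 a a4 b1 b2 b3 c d : R) (a' := d * (a + c * a4)) :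
  d != 0 ->
  alg_isomorphic (msc_mul (mx2x4 a1 a a a4 b1 b2 b3 (- a)))
    (msc_mul (mx2x4 (a1 + 2 * a * c + c ^+ 2 * a4) a' a' (d ^+ 2 * a4)
       ((b1 + c * (b2 + b3 - a1) - 3 * a * c ^+ 2 - c ^+ 3 * a4) / d)
       (b2 - 2 * c * a - c ^+ 2 * a4) (b3 - 2 * c * a - c ^+ 2 * a4) (- a'))).
Proof.
move=> dN0; apply/alg_isomorphic_sym/alg_isomorphic_mx2x4P.
exists 1, c, 0, d => /=; split; first by rewrite mulr0 subr0 mul1r.
  by split; rewrite /bil2 /a'; ring.
by split; rewrite /bil2 /a'; field.
Qed.

(* The possible values of the structure constants of an algebra in which both
   trace forms are multiples of a nonzero form, in a basis (e1, e2) such that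
   this form takes the values (1, 0). *)
Variant normal_form (a1 a a4 b1 b2 b3 : R) : Prop :=
| NormalDefinite of a = 0 & a4 = 1 & 0 <= b1
| NormalIndefinite of a = 0 & a4 = -1 & 0 <= b1
| NormalNonzeroA of a1 = 0 & a = 1 & a4 = 0
| NormalSplit of a = 0 & a4 = 0 & b1 = 0
| NormalNonsplit of a = 0 & a4 = 0 & b1 = 1 & b2 + b3 = a1.

(** The parameter [c] shifts one constant to 0 and [d] rescales another. The first nonzero quantity
    among [a4], [a], [b2 + b3 - a1] decides whether [a], [a1] or [b1] can be shifted away. *)
Lemma normal_form_exists (a1 a a4 b1 b2 b3 : R) :
  exists a1' a' a4' b1' b2' b3', [/\ normal_form a1' a' a4' b1' b2' b3',
    a1' + b2' = a1 + b2, a1' + b3' = a1 + b3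
    & alg_isomorphic (msc_mul (mx2x4 a1 a a a4 b1 b2 b3 (- a)))
        (msc_mul (mx2x4 a1' a' a' a4' b1' b2' b3' (- a')))].
Proof.
suff [c [d [dN0 nf]]] : exists c d : R, d != 0 /\
    normal_form (a1 + 2 * a * c + c ^+ 2 * a4) (d * (a + c * a4)) (d ^+ 2 * a4)
       ((b1 + c * (b2 + b3 - a1) - 3 * a * c ^+ 2 - c ^+ 3 * a4) / d)
       (b2 - 2 * c * a - c ^+ 2 * a4) (b3 - 2 * c * a - c ^+ 2 * a4).
  do 6 eexists; split; [exact: nf | ring | ring | exact: triangular_change].
have [a40 | a4N0] := eqVneq a4 0.
  rewrite {}a40; have [-> | aN0] := eqVneq a 0; last first.
    exists (- a1 / (2 * a)), a^-1; split; first by rewrite invr_eq0.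
    by apply: NormalNonzeroA; field.
  have [w0 | wN0] := eqVneq (b2 + b3 - a1) 0; last first.
    exists (- b1 / (b2 + b3 - a1)), 1; split; first exact: oner_neq0.
    by apply: NormalSplit; field.
  have [-> | b1N0] := eqVneq b1 0.
    exists 0, 1; split; first exact: oner_neq0.
    by apply: NormalSplit; ring.
  exists 0, b1; split=> //.
  by apply: NormalNonsplit; [ring | ring | field | lra].
(* This [c] kills [a], and [X] is the resulting numerator of the new [b1]. *)
pose c := - a / a4; pose X := b1 + c * (b2 + b3 - a1) - 3 * a * c ^+ 2 - c ^+ 3 * a4.
pose d0 := (Num.sqrt `|a4|)^-1.
have d0gt0 : 0 < d0 by rewrite invr_gt0 sqrtr_gt0 normr_gt0.
(* The absolute value of [d] brings [a4] to 1 or -1; its sign is free and makes the new [b1]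
   nonnegative. *)
pose d := if 0 <= X then d0 else - d0.
have dN0 : d != 0 by rewrite /d; case: ifP; rewrite ?oppr_eq0 gt_eqF.
have d2 : d ^+ 2 = `|a4|^-1.
  have -> : d ^+ 2 = d0 ^+ 2 by rewrite /d; case: ifP; rewrite ?sqrrN.
  by rewrite exprVn sqr_sqrtr.
have Xd : 0 <= X / d.
  rewrite /d; case: ifPn => [X0|]; first by rewrite divr_ge0 // ltW.
  by rewrite -ltNge invrN mulrN -mulNr => /ltW X0; rewrite divr_ge0 ?oppr_ge0 // ltW.
exists c, d; split=> //.
have aE : d * (a + c * a4) = 0 by rewrite /c; field.
case: (ltrgt0P a4) (a4N0) (d2) => // [a4gt0|a4lt0] _ d2E.
  by apply: NormalDefinite => //; rewrite d2E mulVf.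
by apply: NormalIndefinite => //; rewrite d2E invrN mulNr mulVf.
Qed.

(** The isomorphism sends e1 to e1 + q e2 and e2 to s e2. It changes [a4] by a square and, when [a4]
    vanishes, [a] by the factor [s]. So two different types can only be the split and the nonsplit
    one, and [b1] separates these. *)
Lemma normal_form_unique (a1 a a4 b1 b2 b3 a1' a' a4' b1' b2' b3' q s : R)
    (A := bil2 a1' a' a' a4') (B := bil2 b1' b2' b3' (- a')) :
  normal_form a1 a a4 b1 b2 b3 -> normal_form a1' a' a4' b1' b2' b3' ->
  s != 0 ->
  [/\ a1 = A 1 q 1 q, a = A 1 q 0 s & a4 = A 0 s 0 s] ->
  [/\ a1 * q + b1 * s = B 1 q 1 q, a * q + b2 * s = B 1 q 0 s,
      a * q + b3 * s = B 0 s 1 q & a4 * q - a * s = B 0 s 0 s] ->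
  [/\ a1 = a1', a = a' & a4 = a4'] /\ [/\ b1 = b1', b2 = b2' & b3 = b3'].
Proof.
rewrite /A /B /bil2 => nf nf' sN0 [E1 E2 E4] [F1 F2 F3 F4].
have {}E1 : a1 = a1' + 2 * a' * q + a4' * q ^+ 2 by rewrite E1; ring.
have {}E2 : a = s * a' + s * q * a4' by rewrite E2; ring.
have {}E4 : a4 = s ^+ 2 * a4' by rewrite E4; ring.
have {}F1 : a1 * q + b1 * s = b1' + (b2' + b3') * q - a' * q ^+ 2 by rewrite F1; ring.
have {}F2 : a * q + b2 * s = b2' * s - a' * q * s by rewrite F2; ring.
have {}F3 : a * q + b3 * s = b3' * s - a' * q * s by rewrite F3; ring.
clear F4 A B.
have s2 : 0 < s ^+ 2 by rewrite exprn_even_gt0.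
have [/orP s_sign] : (s < 0) || (0 < s) by rewrite -neq_lt.
have q0 : s * q = 0 -> q = 0.
  by move=> /eqP; rewrite mulf_eq0 (negPf sN0) => /eqP.
have divs x y : x * s = y * s -> x = y by apply: mulIf.
have sgn1 : s ^+ 2 = 1 -> s = 1 \/ s = -1.
  by move=> /eqP; rewrite sqrf_eq1 => /orP[] /eqP; [left|right].
case: nf' => [a'E a4'E b1'E|a'E a4'E b1'E|a1'E a'E a4'E|a'E a4'E b1'E|a'E a4'E b1'E wE];
  rewrite {}a'E {}a4'E ?a1'E in E1 E2 E4 F1 F2 F3 *;
  case: nf => [aE a4E b1E|aE a4E b1E|a1E aE a4E|aE a4E b1E|aE a4E b1E wE'];
  rewrite {}aE {}a4E ?a1E in E1 E2 E4 F1 F2 F3 *;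
  try by exfalso; case: s_sign; lra.
(* Here [q = 0] and [s ^+ 2 = 1]; if [s = -1], the sign conditions force [b1] and [b1'] to be 0. *)
1, 2: have {q0 E2} q0 : q = 0 by [apply: q0; lra];
  rewrite {}q0 in E1 F1 F2 F3;
  (have -> : b2 = b2' by [apply: divs; lra]);
  (have -> : b3 = b3' by [apply: divs; lra]);
  (have {}/sgn1[s1|s1] : s ^+ 2 = 1 by lra);
  by rewrite {}s1 in F1; do ! split; lra.
- have s1 : s = 1 by lra.
  have q0' : q = 0 by lra.
  by rewrite {}s1 {}q0' in F1 F2 F3; do ! split; lra.
all: have {}E1 : a1 = a1' by [lra]; subst a1'.
all: have {}F2 : b2 = b2' by [apply: divs; lra].
all: have {}F3 : b3 = b3' by [apply: divs; lra].
all: subst b2' b3'.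
- by rewrite b1E b1'E.
(* In the two mixed cases [b2 + b3 = a1] cancels [q] from [F1], leaving [b1 * s = b1'] with exactly
   one of [b1], [b1'] zero. *)
- by exfalso; rewrite wE' b1E b1'E in F1; case: s_sign; lra.
- by exfalso; rewrite E1 b1E b1'E in F1; lra.
- by rewrite b1E b1'E.
Qed.

End Invariants.

(** * Existence of a canonical representative *)

Section Classification.
Variable R : realType.

(** Either the right trace form is 1 at e1, or it is 0 there and the left one is 1; this separates
    [A2], ..., [A6] from [A7], ..., [A11]. *)
Definition trace_normalized (a1 b2 b3 : R) : Prop :=
  a1 + b3 = 1 \/ a1 + b3 = 0 /\ a1 + b2 = 1.

(** Five normal forms and two normalizations give ten families. In the nonsplit form, [b2 + b3 = a1]
    forces [b2 = 2 * a1 - 1] in [A6] and [a1 = 1 / 3] in [A11]. *)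
Lemma normal_form_canonical (a1 a a4 b1 b2 b3 : R) :
  normal_form a1 a a4 b1 b2 b3 -> trace_normalized a1 b2 b3 ->
  exists2 c, admissible c & mx2x4 a1 a a a4 b1 b2 b3 (- a) = msc c.
Proof.
case=> [-> -> b10|-> -> b10|-> -> ->|-> -> ->|-> -> -> wE]; case=> [tE|[tE tE']].
- by exists (A2 a1 b1 b2) => //; congr mx2x4; lra.
- by exists (A7 a1 b1) => //; congr mx2x4; lra.
- by exists (A3 a1 b1 b2) => //; congr mx2x4; lra.
- by exists (A8 a1 b1) => //; congr mx2x4; lra.
- by exists (A4 b1 b2) => //; congr mx2x4; lra.
- by exists (A9 b1) => //; congr mx2x4; lra.
- by exists (A5 a1 b2) => //; congr mx2x4; lra.
- by exists (A10 a1) => //; congr mx2x4; lra.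
- by exists (A6 a1) => //; congr mx2x4; lra.
- by exists (A11 R) => //; congr mx2x4; lra.
Qed.

(** The kinds are distinguished by the dimension of the span of the two trace forms. *)
Variant msc_kind (c : canonical_alg R) : Prop :=
| TraceRankTwo a1 a2 a4 b1 of c = A1 a1 a2 a4 b1
| TraceRankOne a1 a a4 b1 b2 b3 of msc c = mx2x4 a1 a a a4 b1 b2 b3 (- a)
    & normal_form a1 a a4 b1 b2 b3 & trace_normalized a1 b2 b3
| TraceZero of [\/ c = A12 R, c = A13 R, c = A14 R | c = A15 R].

Lemma msc_kindP (c : canonical_alg R) : admissible c -> msc_kind c.
Proof.
case: c => [x1 x2 x3 x4|x1 x2 x3|x1 x2 x3|x1 x2|x1 x2|x1|x1 x2|x1 x2|x1|x1| | | | | ] /= ac.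
- exact: TraceRankTwo.
- apply: (@TraceRankOne _ x1 0 1 x2 x3 (1 - x1)); first by rewrite oppr0.
    exact: NormalDefinite.
  by left; ring.
- apply: (@TraceRankOne _ x1 0 (-1) x2 x3 (1 - x1)); first by rewrite oppr0.
    exact: NormalIndefinite.
  by left; ring.
- apply: (@TraceRankOne _ 0 1 0 x1 x2 1) => //; first exact: NormalNonzeroA.
  by left; ring.
- apply: (@TraceRankOne _ x1 0 0 0 x2 (1 - x1)); first by rewrite oppr0.
    exact: NormalSplit.
  by left; ring.
- apply: (@TraceRankOne _ x1 0 0 1 (2 * x1 - 1) (1 - x1)); first by rewrite oppr0.
    by apply: NormalNonsplit => //; ring.
  by left; ring.
- apply: (@TraceRankOne _ x1 0 1 x2 (1 - x1) (- x1)); first by rewrite oppr0.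
    exact: NormalDefinite.
  by right; split; ring.
- apply: (@TraceRankOne _ x1 0 (-1) x2 (1 - x1) (- x1)); first by rewrite oppr0.
    exact: NormalIndefinite.
  by right; split; ring.
- apply: (@TraceRankOne _ 0 1 0 x1 1 0) => //; first exact: NormalNonzeroA.
  by right; split; ring.
- apply: (@TraceRankOne _ x1 0 0 0 (1 - x1) (- x1)); first by rewrite oppr0.
    exact: NormalSplit.
  by right; split; ring.
- apply: (@TraceRankOne _ (1 / 3) 0 0 1 (2 / 3) (- (1 / 3))); first by rewrite oppr0.
    by apply: NormalNonsplit => //; lra.
  by right; split; lra.
- by apply: TraceZero; constructor 1.
- by apply: TraceZero; constructor 2.
- by apply: TraceZero; constructor 3.
- by apply: TraceZero; constructor 4.
Qed.

(** Members whose trace forms span a line are compared through their matrices; this recovers the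
    parameters. *)
Lemma msc_inj : injective (@msc R).
Proof.
case=> [x1 x2 x3 x4|x1 x2 x3|x1 x2 x3|x1 x2|x1 x2|x1|x1 x2|x1 x2|x1|x1| | | | | ];
case=> [y1 y2 y3 y4|y1 y2 y3|y1 y2 y3|y1 y2|y1 y2|y1|y1 y2|y1 y2|y1|y1| | | | | ];
move=> /mx2x4_inj[[E1 E2 E3 E4] [F1 F2 F3 F4]]; solve [by exfalso; lra | congruence].
Qed.

Lemma cubic_root (k0 k1 k2 k3 : R) :
  k3 != 0 -> exists x, k0 + k1 * x + k2 * x ^+ 2 + k3 * x ^+ 3 = 0.
Proof.
move=> k3N0; have [|x] := @odd_poly_root _ (Poly [:: k0; k1; k2; k3]).
  by rewrite (PolyK (c := 0)).
rewrite /root horner_Poly /= => /eqP rx; exists x; rewrite -[RHS]rx; ring.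
Qed.

(** With [a4 = 0] the line of e2 is closed under the product. If [a] is nonzero, all constants but
    [b1] can be fixed, and [b1] then counts up to squares; if [a = 0], the result is [A14] or
    [A15]. *)
Lemma traceless_eigen_canonical (a1 a b1 : R) :
  ~ [/\ a1 = 0, a = 0 & b1 = 0] ->
  exists2 c, [\/ c = A12 R, c = A13 R, c = A14 R | c = A15 R]
    & alg_isomorphic (msc_mul (mx2x4 a1 a a 0 b1 (- a1) (- a1) (- a)))
        (msc_mul (msc c)).
Proof.
move=> nz; have [a0|aN0] := eqVneq a 0.
  rewrite {a}a0 in nz *; have [a10|a1N0] := eqVneq a1 0.
    rewrite {a1}a10 in nz *.
    have b1N0 : b1 != 0 by apply/eqP => b10; apply: nz.
    exists (A15 R); first by constructor 4.
    have := triangular_change 0 0 0 b1 0 0 0 b1N0.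
    rewrite !oppr0; congr (alg_isomorphic (msc_mul _) (msc_mul _)).
    by congr mx2x4; field.
  exists (A14 R); first by constructor 3.
  apply/alg_isomorphic_sym/alg_isomorphic_mx2x4P.
  (* The new e1 is the old e2, of square 0. The new e2 acts on it as 1, and its second coordinate is
     fitted to make its square its opposite. *)
  exists 0, 1, (- a1^-1), (- b1 / (3 * a1 ^+ 2)); split.
  - by rewrite mul0r mul1r sub0r opprK invr_eq0.
  - by split; rewrite /bil2; field.
  - by split; rewrite /bil2; field.
have aVN0 : a^-1 != 0 by rewrite invr_eq0.
(* This [c] kills [a1], and with it [b2] and [b3]; this [d] makes [a] equal to 1. *)
have := triangular_change a1 a 0 b1 (- a1) (- a1) (- a1 / (2 * a)) aVN0.
set B := mx2x4 _ _ _ _ ((_ / _)) _ _ _ => isoB.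
have [b EB] : exists b, B = mx2x4 0 1 1 0 b 0 0 (-1).
  by eexists; congr mx2x4; field.
rewrite {}EB in isoB => {B}.
(* Multiplying e1 by [k] changes [b] by [k ^+ 2], so only its sign matters. *)
have scale k : k != 0 -> alg_isomorphic (msc_mul (mx2x4 0 1 1 0 b 0 0 (-1)))
    (msc_mul (mx2x4 0 1 1 0 (k ^+ 2 * b) 0 0 (-1))).
  move=> kN0; apply/alg_isomorphic_sym/alg_isomorphic_mx2x4P.
  exists k, 0, 0, 1; split; first by rewrite mulr1 mul0r subr0.
    by split; rewrite /bil2; ring.
  by split; rewrite /bil2; ring.
have [b0|bN0] := eqVneq b 0.
  by exists (A14 R); [constructor 3 | rewrite {}b0 in isoB].
pose k := (Num.sqrt `|b|)^-1.
have kN0 : k != 0 by rewrite invr_eq0 sqrtr_eq0 -ltNge normr_gt0.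
have k2 : k ^+ 2 = `|b|^-1 by rewrite exprVn sqr_sqrtr.
have := alg_isomorphic_trans isoB (scale k kN0); rewrite k2.
case: (ltrgt0P b) (bN0) => // [bgt0|blt0] _.
  by rewrite mulVf //; exists (A12 R) => //; constructor 1.
by rewrite invrN mulNr mulVf //; exists (A13 R) => //; constructor 2.
Qed.

(* If e1 + x e2 is a root of the cubic det (u, u * u), taking it as the new e2
   makes e2 * e2 a multiple of e2. *)
Lemma traceless_canonical (a1 a a4 b1 : R) :
  ~ [/\ a1 = 0, a = 0, a4 = 0 & b1 = 0] ->
  exists2 c, [\/ c = A12 R, c = A13 R, c = A14 R | c = A15 R]
    & alg_isomorphic (msc_mul (mx2x4 a1 a a a4 b1 (- a1) (- a1) (- a)))
        (msc_mul (msc c)).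
Proof.
move=> nz; have [a40|a4N0] := eqVneq a4 0.
  rewrite {a4}a40 in nz *; apply: traceless_eigen_canonical => -[a10 a0 b10].
  exact: nz.
have a4N0' : - a4 != 0 by rewrite oppr_eq0.
have [x rx] := cubic_root b1 (- 3 * a1) (- 3 * a) a4N0'.
have := triangular_change a1 a a4 b1 (- a1) (- a1) x (oner_neq0 R).
set A := mx2x4 a1 _ _ _ _ _ _ _; set B := mx2x4 _ _ _ _ _ _ _ _ => isoB.
pose a1' := a1 + 2 * a * x + x ^+ 2 * a4; pose a' := a + x * a4.
have EB : B = mx2x4 a1' a' a' a4 0 (- a1') (- a1') (- a').
  rewrite /B /a1' /a'; congr mx2x4; try ring.
  by rewrite -rx divr1; ring.
(* The root is still the first basis vector; exchanging the two makes it e2. *)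
have isoC : alg_isomorphic (msc_mul B)
    (msc_mul (mx2x4 (- a') (- a1') (- a1') 0 a4 (- - a') (- - a') (- - a1'))).
  rewrite EB; apply/alg_isomorphic_sym/alg_isomorphic_mx2x4P.
  exists 0, 1, 1, 0; split; first by rewrite mul0r mul1r sub0r oppr_eq0 oner_neq0.
    by split; rewrite /bil2; ring.
  by split; rewrite /bil2; ring.
have [|c cE isoc] := @traceless_eigen_canonical (- a') (- a1') a4.
  by move=> [_ _ a40]; rewrite a40 eqxx in a4N0.
by exists c => //; apply: alg_isomorphic_trans isoB (alg_isomorphic_trans isoC isoc).
Qed.

(** Both forms vanish at e2, whence [a3 = a2] and [b4 = - a2]. Reduction to normal form preserves
    the traces at e1, hence the normalization. *)
Lemma trace_rank_one_canonical (a1 a2 a3 a4 b1 b2 b3 b4 : R) :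
  trace_normalized a1 b2 b3 -> a3 + b4 = 0 -> a2 + b4 = 0 ->
  exists2 c, admissible c
    & alg_isomorphic (msc_mul (mx2x4 a1 a2 a3 a4 b1 b2 b3 b4)) (msc_mul (msc c)).
Proof.
move=> tn t1 t2; have -> : a3 = a2 by lra.
have -> : b4 = - a2 by lra.
have [a1' [a' [a4' [b1' [b2' [b3' [nf E2 E3 iso]]]]]]] :=
  normal_form_exists a1 a2 a4 b1 b2 b3.
have [|c ac mE] := normal_form_canonical nf.
  by rewrite /trace_normalized E2 E3.
by exists c => //; rewrite -mE.
Qed.

(** The first vector is w / |w|^2; the second spans the kernel of w and is thus killed by every form
    proportional to w. *)
Lemma dual_basis (w1 w2 : R) : (w1 != 0) || (w2 != 0) ->
  exists p q r s : R, [/\ p * s - q * r != 0, w1 * p + w2 * q = 1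
    & forall z1 z2, w1 * z2 = w2 * z1 -> z1 * r + z2 * s = 0].
Proof.
move=> wN0; pose n := w1 ^+ 2 + w2 ^+ 2.
have nN0 : n != 0.
  by rewrite paddr_eq0 ?sqr_ge0 // !sqrf_eq0 negb_and.
exists (w1 / n), (w2 / n), (- w2), w1; rewrite /n in nN0 *; split.
- have -> : w1 / n * w1 - w2 / n * - w2 = 1 by rewrite /n; field.
  exact: oner_neq0.
- by field.
- by move=> z1 z2 E; rewrite mulrN [z2 * _]mulrC E; ring.
Qed.

Lemma exists_canonical (a1 a2 a3 a4 b1 b2 b3 b4 : R) :
  mx2x4 a1 a2 a3 a4 b1 b2 b3 b4 <> 0 ->
  exists2 c, admissible c
    & alg_isomorphic (msc_mul (mx2x4 a1 a2 a3 a4 b1 b2 b3 b4)) (msc_mul (msc c)).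
Proof.
(* [D] is the determinant of the right and left trace forms. *)
move=> nz; pose D := (a1 + b3) * (a3 + b4) - (a2 + b4) * (a1 + b2).
have [D0|DN0] := eqVneq D 0; last first.
  (* These entries of the inverse matrix give the basis dual to the right and left trace forms. *)
  have dE : (a3 + b4) / D * ((a1 + b3) / D) - - (a1 + b2) / D * (- (a2 + b4) / D) = D^-1.
    by rewrite /D in DN0 *; field.
  have dN0 : (a3 + b4) / D * ((a1 + b3) / D) - - (a1 + b2) / D * (- (a2 + b4) / D) != 0.
    by rewrite dE invr_eq0.
  have [a1' [a2' [a3' [a4' [b1' [b2' [b3' [b4' [iso [L1 L2 R1 R2]]]]]]]]]] :=
    change_of_basis a1 a2 a3 a4 b1 b2 b3 b4 dN0.
  have {}L1 : a1' + b2' = 0 by rewrite L1; ring.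
  have {}L2 : a3' + b4' = 1 by rewrite L2 /D in DN0 *; field.
  have {}R1 : a1' + b3' = 1 by rewrite R1 /D in DN0 *; field.
  have {}R2 : a2' + b4' = 0 by rewrite R2; ring.
  exists (A1 a1' a2' a4' b1') => //.
  have -> : msc (A1 a1' a2' a4' b1') = mx2x4 a1' a2' a3' a4' b1' b2' b3' b4'.
    by congr mx2x4; lra.
  by [].
(* If the right form is nonzero, [D = 0] makes the left one a multiple of it. *)
have [rN0|] := boolP ((a1 + b3 != 0) || (a2 + b4 != 0)).
  have [p [q [r [s [dN0 E1 E0]]]]] := dual_basis rN0.
  have [a1' [a2' [a3' [a4' [b1' [b2' [b3' [b4' [iso [L1 L2 R1 R2]]]]]]]]]] :=
    change_of_basis a1 a2 a3 a4 b1 b2 b3 b4 dN0.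
  have [||| c ac isoc] := @trace_rank_one_canonical a1' a2' a3' a4' b1' b2' b3' b4'.
  - by left; rewrite R1.
  - by rewrite L2 E0 //; apply/eqP; rewrite -subr_eq0 -[_ - _]/D D0.
  - by rewrite R2 E0 //; ring.
  by exists c => //; apply: alg_isomorphic_trans iso isoc.
rewrite negb_or !negbK => /andP[/eqP r10 /eqP r20].
have [lN0|] := boolP ((a1 + b2 != 0) || (a3 + b4 != 0)).
  have [p [q [r [s [dN0 E1 E0]]]]] := dual_basis lN0.
  have [a1' [a2' [a3' [a4' [b1' [b2' [b3' [b4' [iso [L1 L2 R1 R2]]]]]]]]]] :=
    change_of_basis a1 a2 a3 a4 b1 b2 b3 b4 dN0.
  have [||| c ac isoc] := @trace_rank_one_canonical a1' a2' a3' a4' b1' b2' b3' b4'.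
  - by right; rewrite R1 L1 r10 r20 E1; split; ring.
  - by rewrite L2 E0 //; ring.
  - by rewrite R2 r10 r20; ring.
  by exists c => //; apply: alg_isomorphic_trans iso isoc.
rewrite negb_or !negbK => /andP[/eqP l10 /eqP l20].
have b2E : b2 = - a1 by lra.
have b3E : b3 = - a1 by lra.
have a3E : a3 = a2 by lra.
have b4E : b4 = - a2 by lra.
rewrite b2E b3E a3E b4E in nz *.
have [|c cE iso] := @traceless_canonical a1 a2 a4 b1.
  move=> [a10 a20 a40 b10]; apply: nz; rewrite a10 a20 a40 b10 !oppr0.
  by apply/matrixP => i j; rewrite !mxE; case: i => [[|[|i]] Hi] //;
    case: j => [[|[|[|[|j]]]] Hj].
by exists c => //; case: cE => ->.
Qed.

End Classification.

(** * Uniqueness of the canonical representative *)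

Section Uniqueness.
Variable R : realType.

(** Pulling back multiplies the determinant of the two trace forms by that of the isomorphism, and
    for [A1] the outcome is 1. *)
Lemma trace_rank_two_iso (x1 x2 x4 y1 a1 a2 a3 a4 b1 b2 b3 b4 : R) :
  alg_isomorphic (msc_mul (msc (A1 x1 x2 x4 y1)))
    (msc_mul (mx2x4 a1 a2 a3 a4 b1 b2 b3 b4)) ->
  (a1 + b3) * (a3 + b4) - (a2 + b4) * (a1 + b2) != 0.
Proof.
move=> /alg_isomorphic_mx2x4P[p [q [r [s /= [dN0 E F]]]]].
have [L1 L2 R1 R2] := trace_forms dN0 E F.
apply/eqP=> D0; have : 0 = 1 :> R; last by move/eqP; rewrite eq_sym oner_eq0.
transitivity (((a1 + b3) * (a3 + b4) - (a2 + b4) * (a1 + b2)) * (p * s - q * r)).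
  by rewrite D0 mul0r.
transitivity ((x1 + (- x1 + 1)) * (x2 + 1 + - x2) - (x2 + - x2) * (x1 + - x1)).
  by rewrite L1 L2 R1 R2; ring.
by ring.
Qed.

Lemma traceless_iso (a1 a2 a3 a4 b1 b2 b3 b4 a1' a2' a4' b1' : R) :
  alg_isomorphic (msc_mul (mx2x4 a1 a2 a3 a4 b1 b2 b3 b4))
    (msc_mul (mx2x4 a1' a2' a2' a4' b1' (- a1') (- a1') (- a2'))) ->
  a1 + b2 = 0 /\ a1 + b3 = 0.
Proof.
move=> /alg_isomorphic_mx2x4P[p [q [r [s /= [dN0 E F]]]]].
have [L1 L2 R1 R2] := trace_forms dN0 E F.
by rewrite L1 R1; split; ring.
Qed.

(** An isomorphism respects the bases dual to the trace forms, hence is the identity in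
    coordinates. *)
Lemma trace_rank_two_unique (a1 a2 a4 b1 a1' a2' a4' b1' : R) :
  alg_isomorphic (msc_mul (msc (A1 a1 a2 a4 b1)))
    (msc_mul (msc (A1 a1' a2' a4' b1'))) ->
  A1 a1 a2 a4 b1 = A1 a1' a2' a4' b1'.
Proof.
move=> /alg_isomorphic_mx2x4P[p [q [r [s /= [dN0 E F]]]]].
have [L1 L2 R1 R2] := trace_forms dN0 E F.
have p1 : p = 1 by lra.
have q0 : q = 0 by lra.
have r0 : r = 0 by lra.
have s1 : s = 1 by lra.
move: E F; rewrite p1 q0 r0 s1 /bil2 => -[E1 E2 E3 E4] [F1 F2 F3 F4].
congr A1; lra.
Qed.

(** The trace values force [p = 1] and [r = 0], which is the setting of [normal_form_unique]. *)
Lemma trace_rank_one_unique (a1 a a4 b1 b2 b3 a1' a' a4' b1' b2' b3' : R) :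
  normal_form a1 a a4 b1 b2 b3 -> trace_normalized a1 b2 b3 ->
  normal_form a1' a' a4' b1' b2' b3' -> trace_normalized a1' b2' b3' ->
  alg_isomorphic (msc_mul (mx2x4 a1 a a a4 b1 b2 b3 (- a)))
    (msc_mul (mx2x4 a1' a' a' a4' b1' b2' b3' (- a'))) ->
  mx2x4 a1 a a a4 b1 b2 b3 (- a) = mx2x4 a1' a' a' a4' b1' b2' b3' (- a').
Proof.
move=> nf tn nf' tn' /alg_isomorphic_mx2x4P[p [q [r [s /= [dN0 E F]]]]].
have [L1 L2 R1 R2] := trace_forms dN0 E F.
rewrite !subrr !mul0r !addr0 in L1 L2 R1 R2.
have r0 : r = 0.
  case: tn' => [t1'|[t1' t2']]; first by rewrite t1' mul1r in R2.
  by rewrite t2' mul1r in L2.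
have p1 : p = 1.
  have pN0 : p != 0.
    by apply: contraNneq dN0 => ->; rewrite r0 mul0r mulr0 subr0.
  case: tn' => [t1'|[t1' t2']].
    rewrite t1' mul1r in R1; case: tn => [t1|[t1 _]]; first by rewrite -R1 t1.
    by rewrite -R1 t1 eqxx in pN0.
  rewrite t2' mul1r in L1; rewrite t1' mul0r in R1; case: tn => [t1|[_ t2]].
    by move/eqP: t1; rewrite R1 eq_sym oner_eq0.
  by rewrite -L1 t2.
rewrite p1 r0 !(mulr1, mul1r, mulr0, subr0, addr0) in dN0 E F.
case: E => E1 E2 _ E4; case: F => F1 F2 F3 F4.
rewrite mulNr in F4.
have [[-> -> ->] [-> -> ->]] // := normal_form_unique nf nf' dN0
  (And3 E1 E2 E4) (And4 F1 F2 F3 F4).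
Qed.

(** Thus the sign of [b] is invariant. Either the image of e2 stays on the line of e2, and [r = 0],
    or it lies on another root line of the cubic, and [s = - (1 / 2)]. *)
Lemma traceless_square_class (b b' : R) :
  alg_isomorphic (msc_mul (mx2x4 0 1 1 0 b 0 0 (-1)))
    (msc_mul (mx2x4 0 1 1 0 b' 0 0 (-1))) ->
  exists2 k, 0 < k & b = k * b'.
Proof.
move=> /alg_isomorphic_mx2x4P[p [q [r [s /= [dN0 E F]]]]].
move: E F; rewrite /bil2 => -[E1 E2 _ E4] [F1 F2 _ F4].
have /eqP : r * (1 + 2 * s) = 0 by lra.
rewrite mulf_eq0 => /orP[/eqP r0|/eqP s_half].
  rewrite {}r0 in dN0 E1 E2 E4 F1 F2 F4.
  have [pN0 sN0] : p != 0 /\ s != 0.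
    by apply/andP; rewrite -negb_or -mulf_eq0 -[p * s]subr0 -{1}(mulr0 q).
  have s1 : s = 1 by apply: (mulIf sN0); lra.
  have q0 : q = 0 by apply: (mulfI pN0); lra.
  exists (p ^+ 2); first by rewrite exprn_even_gt0.
  by rewrite s1 q0 in F1; lra.
have sE : s = - (1 / 2) by lra.
rewrite {}sE in dN0 E1 E2 E4 F1 F2 F4.
(* [F4] now says that [b' * r ^+ 2] is 3/4. *)
have rN0 : r != 0 by apply/eqP=> r0; rewrite r0 in F4; lra.
have qE : q = 2 * b' * p * r by lra.
have pN0 : p != 0.
  by apply: contraNneq dN0 => p0; rewrite qE p0; apply/eqP; ring.
exists (4 * p ^+ 2); first by rewrite mulr_gt0 // exprn_even_gt0.
by apply: (mulIf rN0); rewrite qE in E1; lra.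
Qed.

(** In the source e1 = e1 * e2 and e2 = - (e2 * e2), whereas all products in [A15] lie on one
    line. *)
Lemma not_iso_A15 (b : R) :
  ~ alg_isomorphic (msc_mul (mx2x4 0 1 1 0 b 0 0 (-1))) (msc_mul (msc (A15 R))).
Proof.
move=> /alg_isomorphic_mx2x4P[p [q [r [s /= [dN0 E F]]]]].
move: E F; rewrite /bil2 => -[E1 E2 _ E4] [F1 F2 _ F4].
have p0 : p = 0 by lra.
have r0 : r = 0 by lra.
by rewrite p0 r0 mul0r mulr0 subr0 eqxx in dN0.
Qed.

Lemma traceless_unique (c c' : canonical_alg R) :
  [\/ c = A12 R, c = A13 R, c = A14 R | c = A15 R] ->
  [\/ c' = A12 R, c' = A13 R, c' = A14 R | c' = A15 R] ->
  alg_isomorphic (msc_mul (msc c)) (msc_mul (msc c')) -> c = c'.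
Proof.
(* [A12], [A13] and [A14] have [b] equal to 1, -1 and 0, which no positive factor relates. *)
case=> ->; case=> -> // iso; exfalso;
  solve [ have [k k0 kE] := traceless_square_class iso; lra
        | exact: not_iso_A15 iso
        | exact: not_iso_A15 (alg_isomorphic_sym iso) ].
Qed.

(** Both trace forms of the target vanish at e2, so their determinant is 0. *)
Lemma A1_not_iso (x1 x2 x4 y1 a1 a a4 b1 b2 b3 : R) :
  ~ alg_isomorphic (msc_mul (msc (A1 x1 x2 x4 y1)))
      (msc_mul (mx2x4 a1 a a a4 b1 b2 b3 (- a))).
Proof. by move/trace_rank_two_iso/eqP; apply; ring. Qed.

(** The rank of the pair of trace forms is invariant, so only algebras of the same kind need a finer
    comparison. *)
Lemma canonical_unique (c c' : canonical_alg R) : admissible c -> admissible c' ->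
  alg_isomorphic (msc_mul (msc c)) (msc_mul (msc c')) -> c = c'.
Proof.
have zeroE d : [\/ d = A12 R, d = A13 R, d = A14 R | d = A15 R] ->
    exists a1 a a4 b1, msc d = mx2x4 a1 a a a4 b1 (- a1) (- a1) (- a).
  case=> ->; [exists 0, 1, 0, 1 | exists 0, 1, 0, (-1) | exists 0, 1, 0, 0
    | exists 0, 0, 0, 1]; by rewrite !oppr0.
have one_zero a1 a a4 b1 b2 b3 d : trace_normalized a1 b2 b3 ->
    [\/ d = A12 R, d = A13 R, d = A14 R | d = A15 R] ->
    ~ alg_isomorphic (msc_mul (mx2x4 a1 a a a4 b1 b2 b3 (- a))) (msc_mul (msc d)).
  move=> tn /zeroE[? [? [? [? ->]]]] /traceless_iso[t1 t2].
  by case: tn => [|[]]; lra.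
move=> /msc_kindP kc /msc_kindP kc' iso; have osi := alg_isomorphic_sym iso.
case: kc => [x1 x2 x4 y1 cE|a1 a a4 b1 b2 b3 cE nf tn|cE];
  case: kc' => [x1' x2' x4' y1' cE'|a1' a' a4' b1' b2' b3' cE' nf' tn'|cE'].
- by rewrite cE cE' in iso *; apply: trace_rank_two_unique.
- by rewrite cE cE' in iso; case: (A1_not_iso iso).
- by have [? [? [? [? E]]]] := zeroE _ cE'; rewrite cE E in iso; case: (A1_not_iso iso).
- by rewrite cE cE' in osi; case: (A1_not_iso osi).
- by apply: msc_inj; rewrite cE cE' in iso *; apply: trace_rank_one_unique.
- by rewrite cE in iso; case: (one_zero _ _ _ _ _ _ _ tn cE' iso).
- by have [? [? [? [? E]]]] := zeroE _ cE; rewrite cE' E in osi; case: (A1_not_iso osi).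
- by rewrite cE' in osi; case: (one_zero _ _ _ _ _ _ _ tn' cE osi).
- exact: traceless_unique.
Qed.

End Uniqueness.

Theorem theorem2p3 (R : realType) (V : vectType R)
    (mul : {bilinear V -> V -> V})
    (dimV : \dim {:V} = 2%N)
    (mul_nontrivial : ~ (forall x y : V, mul x y = 0)) :
  exists! c : canonical_alg R,
    admissible c /\ alg_isomorphic mul (msc_mul (msc c)).
Proof.
have [A isoA] := exists_msc mul dimV.
have [a1 [a2 [a3 [a4 [b1 [b2 [b3 [b4 AE]]]]]]]] := mx2x4_eta A.
have AN0 : A <> 0.
  move=> A0; apply: mul_nontrivial => x y; have [f [bf fM]] := isoA.
  by apply: (bij_inj bf); rewrite fM linear0 A0 /= /msc_mul mul0mx.
rewrite {}AE in isoA AN0; have [c ac isoc] := exists_canonical AN0.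
have iso := alg_isomorphic_trans isoA isoc.
exists c; split=> // c' [ac' iso']; apply: canonical_unique => //.
exact: alg_isomorphic_trans (alg_isomorphic_sym iso) iso'.
Qed.
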